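(* Let $D$ be an integral domain and let $\star$ be an eab semistar operation on $D$. Then $\star_f={\circlearrowleft_{\mathrm{Kr}}}=b(\star)=\star_a$.
   Context: Let $D$ be an integral domain with quotient field $K$. $\overline{\boldsymbol F}(D)$ is the set of all nonzero $D$-submodules of $K$, and $\boldsymbol f(D)$ is the set of all nonzero finitely generated fractional ideals of $D$. For $D$-submodules $A,B$ of $K$, $(A:B)=\{z\in K: zB\subseteq A\}$. A semistar operation of $D$ is a map $\star:\overline{\boldsymbol F}(D)\to\overline{\boldsymbol F}(D)$, $E\mapsto E^\star$, such that for all $0\ne z\in K$ and all $E,F\in\overline{\boldsymbol F}(D)$: $(zE)^\star=zE^\star$; $E\subseteq F$ implies $E^\star\subseteq F^\star$; $E\subseteq E^\star$ and $(E^\star)^\star=E^\star$. By convention $(0)^\star=(0)$. $\star$ is eab if, for all $F,G,H\in\boldsymbol f(D)$, $(FG)^\star\subseteq(FH)^\star$ implies $G^\star\subseteq H^\star$. $\star_f$ is defined by $E^{\star_f}=\bigcup\{F^\star: F\in\boldsymbol f(D),\ F\subseteq E\}$ for $E\in\overline{\boldsymbol F}(D)$. A valuation overring $V$ of $D$ (a valuation domain with $D\subseteq V\subseteq K$) is a $\star$-valuation overring if $F^\star\subseteq FV$ for each $F\in\boldsymbol f(D)$. The semistar operation $b(\star)$ is defined by $E^{b(\star)}=\bigcap\{EV: V \text{ a } \star\text{-valuation overring of } D\}$. For an indeterminate $X$ over $D$ and $h\in D[X]$, $\boldsymbol c(h)$ denotes the content of $h$, i.e. the ideal of $D$ generated by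 its coefficients. The semistar Kronecker function ring is $$\mathrm{Kr}(D,\star)=\{f/g: f,g\in D[X],\ g\ne0,\ \text{there exists } h\in D[X]\setminus\{0\}\text{ with }(\boldsymbol c(f)\boldsymbol c(h))^\star\subseteq(\boldsymbol c(g)\boldsymbol c(h))^\star\},$$ which is a subring of $K(X)$, and ${\circlearrowleft_{\mathrm{Kr}}}$ is the semistar operation on $D$ defined by $E^{\circlearrowleft_{\mathrm{Kr}}}=E\,\mathrm{Kr}(D,\star)\cap K$ for $E\in\overline{\boldsymbol F}(D)$. The semistar operation $\star_a$ is defined by $F^{\star_a}=\bigcup\{((FH)^\star:H^\star): H\in\boldsymbol f(D)\}$ for $F\in\boldsymbol f(D)$, and $E^{\star_a}=\bigcup\{F^{\star_a}: F\in\boldsymbol f(D),\ F\subseteq E\}$ for $E\in\overline{\boldsymbol F}(D)$. *)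

(* Defs.v *)
From mathcomp Require Import all_boot all_order all_algebra.
From mathcomp Require Import boolp classical_sets.

Set Implicit Arguments.
Unset Strict Implicit.
Unset Printing Implicit Defensive.

Import GRing.Theory.

Local Open Scope classical_set_scope.
Local Open Scope ring_scope.

Local Notation tofrac := (@FracField.tofrac _).
Local Notation "x %:F" := (tofrac x) : ring_scope.

(* The additive subgroup generated by the products x * y, x in A and y in B. It
   serves for the products FG and EV in K, and for E Kr(D,star) in K(X). *)
Definition mulset (R : comNzRingType) (A B : set R) : set R :=
  [set z | exists n (a b : 'I_n -> R),
    (forall i, A (a i) /\ B (b i)) /\ z = \sum_(i < n) a i * b i].

Definition scaleset (R : comNzRingType) (z : R) (A : set R) : set R :=
  [set z * x | x in A].

Definition colon (R : comNzRingType) (A B : set R) : set R :=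
  [set z | scaleset z B `<=` A].

Section Semistar.
Variable D : idomainType.
Local Notation K := {fraction D}.

Definition is_submodule (E : set K) : Prop :=
  GRing.zmod_closed [in E] /\ forall (d : D) (x : K), E x -> E (d%:F * x).

Definition Fbar : set (set K) :=
  [set E | is_submodule E /\ E <> [set 0]].

Definition Dspan (s : seq K) : set K :=
  [set x | exists c : 'I_(size s) -> D, x = \sum_(i < size s) (c i)%:F * s`_i].

Definition is_fractional_ideal (E : set K) : Prop :=
  is_submodule E /\
  exists2 d : D, d != 0 & scaleset d%:F E `<=` range (fun a : D => a%:F : K).

Definition fgideals : set (set K) :=
  [set F | [/\ is_fractional_ideal F, F <> [set 0]
             & exists s : seq K, F = Dspan s]].

(* Values outside of Fbar are irrelevant, except for the convention at (0). *)
Record is_semistar (star : set K -> set K) : Prop := IsSemistar {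
  semistar_Fbar : forall E, Fbar E -> Fbar (star E) ;
  semistar_scale : forall (z : K) E, z != 0 -> Fbar E ->
    star (scaleset z E) = scaleset z (star E) ;
  semistar_mono : forall E F, Fbar E -> Fbar F -> E `<=` F -> star E `<=` star F ;
  semistar_ext : forall E, Fbar E -> E `<=` star E ;
  semistar_idem : forall E, Fbar E -> star (star E) = star E ;
  semistar_zero : star [set 0] = [set 0]
}.

Definition eab (star : set K -> set K) : Prop :=
  forall F G H, fgideals F -> fgideals G -> fgideals H ->
    star (mulset F G) `<=` star (mulset F H) -> star G `<=` star H.

Definition star_f (star : set K -> set K) (E : set K) : set K :=
  \bigcup_(F in [set F | fgideals F /\ F `<=` E]) star F.

(* Since V contains D, its quotient field is K, so that the last condition says
   that V is a valuation domain. *)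
Definition is_valuation_overring (V : set K) : Prop :=
  [/\ GRing.subring_closed [in V],
      range (fun a : D => a%:F : K) `<=` V
    & forall x : K, x != 0 -> V x \/ V x^-1].

Definition is_star_valuation_overring (star : set K -> set K) (V : set K) : Prop :=
  is_valuation_overring V /\
  forall F, fgideals F -> star F `<=` mulset F V.

Definition bstar (star : set K -> set K) (E : set K) : set K :=
  \bigcap_(V in is_star_valuation_overring star) mulset E V.

(* The content is an ideal of D, seen here inside K. *)
Definition content (h : {poly D}) : set K :=
  Dspan [seq c%:F | c <- (h : seq D)].

(* K(X) is the fraction field of K[X]. *)
Local Notation KX := {fraction {poly {fraction D}}}.

Definition K_to_KX (x : K) : KX := (x%:P)%:F.

Definition DX_to_KX (f : {poly D}) : KX :=
  (map_poly (fun a : D => a%:F : K) f)%:F.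

Definition Kr (star : set K -> set K) : set KX :=
  [set phi | exists f g : {poly D},
    [/\ g != 0,
        (exists2 h : {poly D}, h != 0 &
           star (mulset (content f) (content h)) `<=`
           star (mulset (content g) (content h)))
      & phi = DX_to_KX f / DX_to_KX g]].

Definition Kr_star (star : set K -> set K) (E : set K) : set K :=
  K_to_KX @^-1` mulset (K_to_KX @` E) (Kr star).

Definition star_a_fg (star : set K -> set K) (F : set K) : set K :=
  \bigcup_(H in fgideals) colon (star (mulset F H)) (star H).

(* For F in fgideals this agrees with star_a_fg star F, which is monotone in F. *)
Definition star_a (star : set K -> set K) (E : set K) : set K :=
  \bigcup_(F in [set F | fgideals F /\ F `<=` E]) star_a_fg star F.

End Semistar.

(* Main.v *)
(* Cancelling H by eab in z H <= (F H)^star gives star_a = star_f. If z lies in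
   F^star with F = (a_0, ..., a_n), put g = sum a_i X^i: the elements z X^i / g
   are in Kr(D, star) and z = sum a_i (z X^i / g), so star_f <= Kr. An element of
   Kr(D, star) lies in the Gauss extension of every star-valuation overring V, so
   by Gauss' lemma Kr <= b(star). Finally let z lie outside E^star_f, and let T be
   maximal among the overrings of D such that z is not in (E T)^star_f. For x <> 0,
   if both T[x] and T[1/x] violated this condition, then z I <= (E T I)^star_f for
   I = (1, x, ..., x^k) with k large, and eab would give z in (E T)^star_f. Hence T
   is a valuation overring; maximality also makes T closed under star_f, so T is a
   star-valuation overring, and z is not in E T. Thus b(star) <= star_f. *)

Require Import Defs.
From mathcomp Require Import all_boot all_order all_algebra.
From mathcomp Require Import boolp classical_sets.

Set Implicit Arguments.
Unset Strict Implicit.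
Unset Printing Implicit Defensive.

Import GRing.Theory.

Local Open Scope classical_set_scope.
Local Open Scope ring_scope.

Local Notation "x %:F" := (@FracField.tofrac _ x) : ring_scope.

(** Directedness merges finitely many indices into one. This yields common denominators, finite sets
    of generators, degree bounds, and a single ring of a chain. *)
Lemma common_index (I T : Type) (J : eqType) (Q : I -> Prop) (R : I -> set T)
    (f : J -> T) (l : seq J) :
  (exists i, Q i) ->
  (forall i j, Q i -> Q j -> exists k, [/\ Q k, R i `<=` R k & R j `<=` R k]) ->
  (forall x, x \in l -> exists2 i, Q i & R i (f x)) ->
  exists2 i, Q i & forall x, x \in l -> R i (f x).
Proof.
move=> [i0 Qi0] dirQ; elim: l => [|a l IH] Ql; first by exists i0.
have [i Qi Ria] := Ql a (mem_head _ _).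
have [|j Qj Rjl] := IH; first by move=> x xl; apply: Ql; rewrite inE xl orbT.
have [k [Qk ik jk]] := dirQ _ _ Qi Qj.
exists k => // x; rewrite inE => /orP[/eqP->|xl]; first exact: ik.
by apply/jk/Rjl.
Qed.

(** * Products of subsets of a commutative ring *)

Section Mulset.
Variable R : comNzRingType.
Implicit Types A B C : set R.

Definition add_closed A := A 0 /\ forall x y, A x -> A y -> A (x + y).

Lemma add_closed_sum A (n : nat) (f : 'I_n -> R) :
  add_closed A -> (forall i, A (f i)) -> A (\sum_i f i).
Proof. by move=> [A0 AD] Af; apply: big_ind. Qed.

Lemma mulset0 A B : mulset A B 0.
Proof.
by exists 0%N, (fun=> 0), (fun=> 0); split; [case | rewrite big_ord0].
Qed.

Lemma mulsetD A B x y : mulset A B x -> mulset A B y -> mulset A B (x + y).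
Proof.
move=> [n [a [b [ab ->]]]] [m [c [d [cd ->]]]].
exists (n + m)%N.
exists (fun i => match split i with inl j => a j | inr j => c j end).
exists (fun i => match split i with inl j => b j | inr j => d j end).
split; first by move=> i; case: (split i).
rewrite big_split_ord /=; congr (_ + _); apply: eq_bigr => i _.
  by rewrite (unsplitK (inl i)).
by rewrite (unsplitK (inr i)).
Qed.

Lemma mulset_add_closed A B : add_closed (mulset A B).
Proof. by split=> [|x y]; [exact: mulset0 | exact: mulsetD]. Qed.

Lemma mulset_mul A B x y : A x -> B y -> mulset A B (x * y).
Proof.
by move=> Ax By; exists 1%N, (fun=> x), (fun=> y); rewrite big_ord1.
Qed.

Lemma mulset_sub A B C : add_closed C ->
  (forall x y, A x -> B y -> C (x * y)) -> mulset A B `<=` C.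
Proof.
move=> addC ABC _ [n [a [b [ab ->]]]]; apply: add_closed_sum => // i.
by have [? ?] := ab i; apply: ABC.
Qed.

Lemma mulset_mono A B A' B' : A `<=` A' -> B `<=` B' ->
  mulset A B `<=` mulset A' B'.
Proof.
move=> AA' BB'; apply: mulset_sub (mulset_add_closed _ _) _ => x y Ax By.
by apply: mulset_mul; [exact: AA' | exact: BB'].
Qed.

Lemma mulsetC A B : mulset A B = mulset B A.
Proof.
suff H A' B' : mulset A' B' `<=` mulset B' A' by apply/seteqP; split; exact: H.
apply: mulset_sub (mulset_add_closed _ _) _ => x y Ax By.
by rewrite mulrC; exact: mulset_mul.
Qed.

Lemma mulset_mull A B C (z : R) : (forall x, A x -> C (z * x)) ->
  forall x, mulset A B x -> mulset C B (z * x).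
Proof.
move=> AC _ [n [a [b [ab ->]]]]; rewrite mulr_sumr.
apply: add_closed_sum (mulset_add_closed _ _) _ => i; rewrite mulrA.
by have [? ?] := ab i; apply: mulset_mul => //; exact: AC.
Qed.

Lemma mulsetA A B C : mulset A (mulset B C) = mulset (mulset A B) C.
Proof.
have sub A' B' C' : mulset A' (mulset B' C') `<=` mulset (mulset A' B') C'.
  apply: mulset_sub (mulset_add_closed _ _) _ => x y Ax.
  by apply: mulset_mull => b Bb; exact: mulset_mul.
apply/seteqP; split; first exact: sub.
by rewrite mulsetC (mulsetC A B) (mulsetC A) (mulsetC B C); exact: sub.
Qed.

Lemma mulset_mulACA A B C E x y : mulset A B x -> mulset C E y ->
  mulset (mulset A C) (mulset B E) (x * y).
Proof.
move=> ABx [n [c [e [ce ->]]]]; rewrite mulr_sumr.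
apply: add_closed_sum (mulset_add_closed _ _) _ => i.
have [Ci Ei] := ce i; case: ABx => m [a [b [ab ->]]]; rewrite mulr_suml.
apply: add_closed_sum (mulset_add_closed _ _) _ => j.
have [Aj Bj] := ab j; rewrite mulrACA.
by apply: mulset_mul; apply: mulset_mul.
Qed.

End Mulset.

(** * Submodules of [K], finite spans and denominators *)

Section Submodules.
Variable D : idomainType.
Local Notation K := {fraction D}.
Implicit Types (E F W : set K) (s t : seq K).

Lemma submoduleP E : is_submodule E <->
  [/\ E 0, forall x y, E x -> E y -> E (x - y)
    & forall (d : D) x, E x -> E (d%:F * x)].
Proof.
split=> [[[E0 EB] EZ]|[E0 EB EZ]]; split => //; first exact: set_mem E0.
  by move=> x y Ex Ey; apply: set_mem; apply: EB; exact: mem_set.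
split; first exact: mem_set.
by move=> x y /set_mem Ex /set_mem Ey; apply: mem_set; exact: EB.
Qed.

Lemma submodule_add_closed E : is_submodule E -> add_closed E.
Proof.
move=> /submoduleP[E0 EB _]; split=> // x y Ex Ey.
by rewrite -[y]opprK -[- y]add0r; apply/EB/EB.
Qed.

Lemma submodule_zero : is_submodule ([set 0] : set K).
Proof.
by apply/submoduleP; split=> // [x y -> ->|d x ->]; rewrite ?subr0 ?mulr0.
Qed.

Lemma mulset_submodule E F : is_submodule E -> is_submodule (mulset E F).
Proof.
move=> /submoduleP[E0 EB EZ]; apply/submoduleP; split; first exact: mulset0.
  move=> x y EFx EFy; apply: mulsetD => //; rewrite -mulN1r.
  by apply: mulset_mull EFy => z Ez; rewrite mulN1r -[- z]add0r; exact: EB.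
by move=> d x; apply: mulset_mull; exact: EZ.
Qed.

Lemma Dspan_submodule s : is_submodule (Dspan s).
Proof.
apply/submoduleP; split.
- by exists (fun=> 0); rewrite big1 // => i _; rewrite rmorph0 mul0r.
- move=> _ _ [c ->] [d ->]; exists (fun i => c i - d i).
  by rewrite -sumrB; apply: eq_bigr => i _; rewrite rmorphB mulrBl.
- move=> d _ [c ->]; exists (fun i => d * c i).
  by rewrite mulr_sumr; apply: eq_bigr => i _; rewrite rmorphM mulrA.
Qed.

Lemma Dspan_mem s x : x \in s -> Dspan s x.
Proof.
move=> xs; have lts : (index x s < size s)%N by rewrite index_mem.
exists (fun i => (i == Ordinal lts)%:R).
rewrite (bigD1 (Ordinal lts)) //= eqxx rmorph1 mul1r nth_index // big1 ?addr0 //.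
by move=> i /negPf ->; rewrite rmorph0 mul0r.
Qed.

Lemma Dspan_sub s E : is_submodule E -> (forall x, x \in s -> E x) ->
  Dspan s `<=` E.
Proof.
move=> subE sE _ [c ->]; apply: add_closed_sum; first exact: submodule_add_closed.
by move=> i; have [_ _ EZ] := (submoduleP E).1 subE; apply/EZ/sE/mem_nth.
Qed.

Lemma Dspan_mono s t : {subset s <= t} -> Dspan s `<=` Dspan t.
Proof.
move=> st; apply: Dspan_sub; first exact: Dspan_submodule.
by move=> x /st; exact: Dspan_mem.
Qed.

Lemma mulset_Dspan s t :
  mulset (Dspan s) (Dspan t) = Dspan [seq x * y | x <- s, y <- t].
Proof.
have sub := Dspan_submodule [seq x * y | x <- s, y <- t].
have [_ _ subZ] := (submoduleP _).1 sub.
apply/seteqP; split; last first.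
  apply: Dspan_sub; first exact/mulset_submodule/Dspan_submodule.
  by move=> _ /allpairsP[[x y] [xs yt ->]]; apply: mulset_mul; exact: Dspan_mem.
apply: mulset_sub => [|_ _ [c ->] [d ->]]; first exact: submodule_add_closed.
rewrite mulr_suml; apply: add_closed_sum => [|i]; first exact: submodule_add_closed.
rewrite mulr_sumr; apply: add_closed_sum => [|j]; first exact: submodule_add_closed.
rewrite mulrACA -rmorphM; apply/subZ/Dspan_mem/allpairsP.
by exists (s`_i, t`_j); split=> //; exact: mem_nth.
Qed.

Lemma scaleset_submodule (z : K) E : is_submodule E -> is_submodule (scaleset z E).
Proof.
move=> /submoduleP[E0 EB EZ]; apply/submoduleP; split.
- by exists 0; rewrite ?mulr0.
- by move=> _ _ [x Ex <-] [y Ey <-]; exists (x - y); rewrite ?mulrBr //; exact: EB.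
- by move=> d _ [x Ex <-]; exists (d%:F * x); rewrite 1?mulrCA //; exact: EZ.
Qed.

(** A finite sum of products involves only finitely many elements of [W]. *)
Lemma mulset_fin W F x : mulset W F x ->
  exists2 s, (forall y, y \in s -> W y) & mulset (Dspan s) F x.
Proof.
move=> [n [a [b [ab ->]]]]; exists (codom a) => [y /codomP[i ->]|].
  by have [] := ab i.
by exists n, a, b; split=> // i; split; [exact/Dspan_mem/codom_f | have [] := ab i].
Qed.

Lemma fraction_numden (x : K) : exists2 d : D, d != 0 & exists n : D, x = n%:F / d%:F.
Proof.
elim/quotW: x => r; exists \d_r; first exact: denom_ratioP.
exists \n_r; apply: canRL (mulfK _) _; first by rewrite tofrac_eq0 denom_ratioP.
(* On representatives, equality of fractions is a cross-product identity. *)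
unlock FracField.tofrac; rewrite -[LHS]FracField.pi_mul.
apply/eqmodP; rewrite /= FracField.equivfE /FracField.mulf.
by rewrite !numden_Ratio ?mulr1 ?oner_eq0 ?denom_ratioP // mulrC.
Qed.

Lemma common_denominator s : exists2 d : D, d != 0 &
  forall x, x \in s -> exists a : D, d%:F * x = a%:F.
Proof.
apply: (common_index (Q := fun d : D => d != 0)
  (R := fun d (x : K) => exists a : D, d%:F * x = a%:F) (f := id)).
- by exists 1; exact: oner_neq0.
- move=> d e d0 e0; exists (d * e); split; first by rewrite mulf_neq0.
    by move=> x [a xa]; exists (e * a); rewrite !tofracM -xa mulrCA mulrA.
  by move=> x [a xa]; exists (d * a); rewrite !tofracM -xa mulrA.
move=> x _; have [d d0 [n ->]] := fraction_numden x; exists d => //; exists n.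
by rewrite mulrC divfK // tofrac_eq0.
Qed.

Lemma nonzero_Dspan s x : x \in s -> x != 0 -> Dspan s <> [set 0].
Proof.
by move=> xs /eqP x0 s0; apply: x0; have := Dspan_mem xs; rewrite s0.
Qed.

(** A common denominator of the generators clears the whole span, so being nonzero is the only
    condition left to check. *)
Lemma fgideals_Dspan s : Dspan s <> [set 0] -> fgideals (Dspan s).
Proof.
move=> sn0; split=> //; last by exists s.
split; first exact: Dspan_submodule.
have [d d0 ds] := common_denominator s; exists d => //.
move=> _ [_ [c ->] <-].
have H i : exists a : D, d%:F * (s : seq K)`_i = a%:F.
  have [lts|les] := ltnP i (size s); first exact/ds/mem_nth.
  by exists 0; rewrite nth_default // mulr0 rmorph0.
have [a Ha] := choice H.
exists (\sum_(i < size s) c i * a i) => //; rewrite rmorph_sum mulr_sumr.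
by apply: eq_bigr => i _; rewrite /= tofracM -Ha mulrCA.
Qed.

Lemma fgideals_Fbar E : fgideals E -> Fbar E.
Proof. by move=> [[? _] ? _]. Qed.

Lemma Fbar_nonzero E : Fbar E -> exists2 x, E x & x != 0.
Proof.
move=> [/submoduleP[E0 _ _] En0]; apply: contrapT => H; apply: En0.
apply/seteqP; split=> x; last by move=> ->.
by move=> Ex; apply/eqP/negPn/negP => x0; apply: H; exists x.
Qed.

Lemma submodule_cases E : is_submodule E -> E = [set 0] \/ Fbar E.
Proof. by move=> subE; have [->|] := pselect (E = [set 0]); [left | right]. Qed.

End Submodules.

(** * Semistar operations on all submodules, and the finite type operation *)

Section Semistar.
Variable D : idomainType.
Local Notation K := {fraction D}.
Implicit Types (E F W T : set K) (s t : seq K).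
Variable star : set K -> set K.
Hypothesis star_semistar : is_semistar star.

(** The axioms concern nonzero submodules; here and in the next lemmas the convention at zero
    extends them to all submodules. *)
Lemma star_submodule E : is_submodule E -> is_submodule (star E).
Proof.
move=> /submodule_cases[->|FE]; first by rewrite semistar_zero //; exact: submodule_zero.
by have [] := semistar_Fbar star_semistar FE.
Qed.

Lemma star_ext E : is_submodule E -> E `<=` star E.
Proof.
move=> /submodule_cases[->|FE]; last exact: semistar_ext.
by rewrite semistar_zero.
Qed.

Lemma star_idem E : is_submodule E -> star (star E) = star E.
Proof.
move=> /submodule_cases[->|FE]; last exact: semistar_idem.
by rewrite !semistar_zero.
Qed.

Lemma star_mono E F : is_submodule E -> is_submodule F -> E `<=` F ->
  star E `<=` star F.
Proof.
move=> subE subF EF; have [F0|FbF] := submodule_cases subF.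
  suff -> : E = F by [].
  apply/seteqP; split=> // x; rewrite F0 => ->.
  by have [] := (submoduleP E).1 subE.
have [E0|FbE] := submodule_cases subE; last exact: semistar_mono.
rewrite E0 semistar_zero // => _ ->.
by have [] := (submoduleP _).1 (star_submodule subF).
Qed.

Lemma star_scale (z : K) E x : is_submodule E -> star E x ->
  star (scaleset z E) (z * x).
Proof.
move=> subE Ex; have [->|z0] := eqVneq z 0.
  rewrite mul0r.
  by have [] := (submoduleP _).1 (star_submodule (scaleset_submodule 0 subE)).
have [E0|FbE] := submodule_cases subE; last first.
  by rewrite semistar_scale //; exists x.
move: Ex; rewrite E0 semistar_zero // => ->; rewrite mulr0.
have -> : scaleset z [set 0] = [set 0].
  apply/seteqP; split=> [_ [_ -> <-]|_ ->] /=; first exact: mulr0.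
  by exists 0; rewrite ?mulr0.
by rewrite semistar_zero.
Qed.

Lemma star_Dspan_sub s E : is_submodule E -> (forall x, x \in s -> star E x) ->
  star (Dspan s) `<=` star E.
Proof.
move=> subE sE; rewrite -(star_idem subE); apply: star_mono.
- exact: Dspan_submodule.
- exact: star_submodule.
- by apply: Dspan_sub => //; exact: star_submodule.
Qed.

Lemma star_Dspan_mono s t : {subset s <= t} -> star (Dspan s) `<=` star (Dspan t).
Proof.
by move=> st; apply: star_mono; try exact: Dspan_submodule; exact: Dspan_mono.
Qed.

(** Scaling twice: for [b] in [F], [b E] lies in [E F], so [x F] lies in [star (mulset E F)]; then
    [F] is scaled by [x], and idempotence concludes. *)
Lemma star_mul E F x y : is_submodule E -> is_submodule F ->
  star E x -> star F y -> star (mulset E F) (x * y).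
Proof.
move=> subE subF Ex Fy; have subEF := mulset_submodule F subE.
rewrite -(star_idem subEF).
apply: star_mono (star_scale x subF Fy); first exact: scaleset_submodule.
  exact: star_submodule.
move=> _ [b Fb <-]; rewrite mulrC.
apply: star_mono (star_scale b subE Ex) => //; first exact: scaleset_submodule.
by move=> _ [a Ea <-]; rewrite mulrC; exact: mulset_mul.
Qed.

(* [star_f] on arbitrary subsets of [K]: nothing is required of [W], and the zero
   module is allowed among the [Dspan s]. *)
Definition fin_star W : set K :=
  [set z | exists2 s, (forall x, x \in s -> W x) & star (Dspan s) z].

Lemma star_fE E : Fbar E -> star_f star E = fin_star E.
Proof.
move=> FE; apply/seteqP; split=> z.
  move=> [_ [[_ _ [s ->]] sE] sz]; exists s => // x xs.
  exact/sE/Dspan_mem.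
(* [Dspan s] may be zero, unlike the members of [fgideals]; adjoining a nonzero [e] of [E] repairs
   this. *)
move=> [s sE sz]; have [e Ee e0] := Fbar_nonzero FE.
exists (Dspan (e :: s)); last first.
  by apply: star_Dspan_mono sz => x xs; rewrite inE xs orbT.
split; last first.
  apply: Dspan_sub; first by case: FE.
  by move=> x; rewrite inE => /orP[/eqP->|/sE].
by apply: fgideals_Dspan; apply: nonzero_Dspan e0; rewrite inE eqxx.
Qed.

Lemma fin_star_mono W T : W `<=` T -> fin_star W `<=` fin_star T.
Proof. by move=> WT z [s sW sz]; exists s => // x /sW /WT. Qed.

Lemma fin_star_ext W : W `<=` fin_star W.
Proof.
move=> x Wx; exists [:: x] => [y|]; first by rewrite inE => /eqP->.
by apply: star_ext; [exact: Dspan_submodule | apply: Dspan_mem; rewrite inE].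
Qed.

Lemma fin_star_submodule W : is_submodule (fin_star W).
Proof.
have subs s := star_submodule (Dspan_submodule s); apply/submoduleP; split.
- by exists [::] => //; have [] := (submoduleP _).1 (subs [::]).
- move=> x y [s sW sx] [t tW ty]; exists (s ++ t) => [w|].
    by rewrite mem_cat => /orP[/sW|/tW].
  have [_ + _] := (submoduleP _).1 (subs (s ++ t)); apply.
    by apply: star_Dspan_mono sx => w ws; rewrite mem_cat ws.
  by apply: star_Dspan_mono ty => w ws; rewrite mem_cat ws orbT.
- move=> d x [s sW sx]; exists s => //.
  by have [_ _ +] := (submoduleP _).1 (subs s); exact.
Qed.

(** The finite lists in [W] are directed by concatenation. *)
Lemma common_subseq W (J : eqType) (R : seq K -> set K) (f : J -> K) (l : seq J) :
  (forall s t, {subset s <= t} -> R s `<=` R t) ->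
  (forall x, x \in l -> exists2 s, (forall y, y \in s -> W y) & R s (f x)) ->
  exists2 s, (forall y, y \in s -> W y) & forall x, x \in l -> R s (f x).
Proof.
move=> Rmono; apply: (common_index (Q := fun s => forall y, y \in s -> W y)).
  by exists [::].
move=> s t sW tW; exists (s ++ t); split.
- by move=> x; rewrite mem_cat => /orP[/sW|/tW].
- by apply: Rmono => x xs; rewrite mem_cat xs.
- by apply: Rmono => x xs; rewrite mem_cat xs orbT.
Qed.

(** The finitely many generators in [s] all lie in [star (Dspan t)] for one list [t] in [W], and
    [star] is idempotent. *)
Lemma star_Dspan_fin_star W s : (forall x, x \in s -> fin_star W x) ->
  star (Dspan s) `<=` fin_star W.
Proof.
move=> /(common_subseq (f := id) star_Dspan_mono)[t tW ts] z sz.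
by exists t => //; apply: star_Dspan_sub sz => //; exact: Dspan_submodule.
Qed.

Lemma fin_star_idem W : fin_star (fin_star W) `<=` fin_star W.
Proof. by move=> z [s sW]; exact: star_Dspan_fin_star. Qed.

Lemma fin_star_mul W T x y : fin_star W x -> fin_star T y ->
  fin_star (mulset W T) (x * y).
Proof.
move=> [s sW sx] [t tT ty]; exists [seq a * b | a <- s, b <- t].
  by move=> _ /allpairsP[[a b] [/sW Wa /tT Tb ->]]; exact: mulset_mul.
by rewrite -mulset_Dspan; apply: star_mul => //; exact: Dspan_submodule.
Qed.

Lemma mulset_fin_star W T : mulset W (fin_star T) `<=` fin_star (mulset W T).
Proof.
apply: mulset_sub; first exact/submodule_add_closed/fin_star_submodule.
by move=> x y Wx Ty; apply: fin_star_mul => //; exact: fin_star_ext.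
Qed.

(** * Cancellation of finitely generated ideals *)

Hypothesis star_eab : eab star.

(** Only finitely many elements [s] of [W] are involved, so [eab] applies with the ideals generated
    by [l], [z] and [s]. *)
Lemma eab_fin_star W (z : K) (l : seq K) : Dspan l <> [set 0] ->
  (forall x, x \in l -> fin_star (mulset W (Dspan l)) (x * z)) -> fin_star W z.
Proof.
move=> ln0 lz; have [->|z0] := eqVneq z 0.
  by have [] := (submoduleP _).1 (fin_star_submodule W).
have subl s : is_submodule (mulset (Dspan s) (Dspan l)).
  exact/mulset_submodule/Dspan_submodule.
have lmono s t : {subset s <= t} ->
    mulset (Dspan s) (Dspan l) `<=` mulset (Dspan t) (Dspan l).
  by move=> st; apply: mulset_mono => //; exact: Dspan_mono.
have [s sW ls] : exists2 s, (forall y, y \in s -> W y) &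
    forall x, x \in l -> star (mulset (Dspan s) (Dspan l)) (x * z).
  apply: (@common_subseq W K (fun s => star (mulset (Dspan s) (Dspan l)))
    (fun x => x * z)) => [s t st|x /lz[g gW gx]]; first exact/star_mono/lmono.
  (* Each of the finitely many elements of [g] needs only finitely many elements of [W]. *)
  have [|s sW gs] := @common_subseq W K
      (fun s => mulset (Dspan s) (Dspan l)) id g lmono.
    by move=> y /gW /mulset_fin.
  by exists s => //; apply: star_Dspan_sub gx => // y /gs; exact: star_ext.
exists s => //.
have zz : Dspan [:: z] z by apply: Dspan_mem; rewrite inE.
have lzls : star (mulset (Dspan l) (Dspan [:: z])) `<=`
    star (mulset (Dspan l) (Dspan s)).
  rewrite (mulsetC _ (Dspan s)) mulset_Dspan; apply: star_Dspan_sub => //.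
  by move=> _ /allpairsP[[x y] /= [/ls xs + ->]]; rewrite inE => /eqP->.
(* [eab] concerns nonzero ideals. If [Dspan s] is zero, a nonzero product [x * z] would lie in [star
   [set 0]]. *)
have [s0|sn0] := pselect (Dspan s = [set 0]); last first.
  apply: (star_eab _ _ _ lzls); try exact: fgideals_Dspan.
    by apply: fgideals_Dspan; apply: nonzero_Dspan z0; rewrite inE.
  by apply: star_ext => //; exact: Dspan_submodule.
have [x xl x0] := Fbar_nonzero (fgideals_Fbar (fgideals_Dspan ln0)).
have sublz := mulset_submodule (Dspan [:: z]) (Dspan_submodule l).
have := lzls _ (star_ext sublz (mulset_mul xl zz)).
have -> : mulset (Dspan l) (Dspan s) = [set 0].
  apply/seteqP; split=> [|_ ->]; last exact: mulset0.
  rewrite s0; apply: mulset_sub; first exact/submodule_add_closed/submodule_zero.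
  by move=> a b _ ->; rewrite /= mulr0.
by rewrite semistar_zero //= => /eqP; rewrite mulf_eq0 (negPf x0) (negPf z0).
Qed.

(** * Overrings of [D] and adjunction of an element *)

Definition is_overring T :=
  GRing.subring_closed [in T] /\ range (fun a : D => a%:F : K) `<=` T.

Lemma overringP T : is_overring T <->
  [/\ T 1, forall x y, T x -> T y -> T (x - y), forall x y, T x -> T y -> T (x * y)
    & forall d : D, T d%:F].
Proof.
split=> [[[T1 TB TM] TD]|[T1 TB TM TD]].
  split; first exact: set_mem T1.
  - by move=> x y Tx Ty; apply: set_mem; apply: TB; exact: mem_set.
  - by move=> x y Tx Ty; apply: set_mem; apply: TM; exact: mem_set.
  - by move=> d; apply: TD; exists d.
split; last by move=> _ [d _ <-].
split; first exact: mem_set.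
- by move=> x y /set_mem Tx /set_mem Ty; apply: mem_set; exact: TB.
- by move=> x y /set_mem Tx /set_mem Ty; apply: mem_set; exact: TM.
Qed.

Lemma overring_submodule T : is_overring T -> is_submodule T.
Proof.
move=> /overringP[T1 TB TM TD]; apply/submoduleP; split=> //.
  by rewrite -(subrr 1); exact: TB.
by move=> d x Tx; exact: TM.
Qed.

Definition powers (x : K) (n : nat) : seq K := [seq x ^+ i | i <- iota 0 n.+1].

Lemma mem_powers (x : K) n i : (i <= n)%N -> x ^+ i \in powers x n.
Proof. by move=> lein; apply: map_f; rewrite mem_iota. Qed.

Lemma powers_sub (x : K) m n : (m <= n)%N -> {subset powers x m <= powers x n}.
Proof.
move=> lemn _ /mapP[i + ->]; rewrite mem_iota /= add0n ltnS => leim.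
exact/mem_powers/(leq_trans leim).
Qed.

Lemma powers_nonzero (x : K) n : Dspan (powers x n) <> [set 0].
Proof. exact: nonzero_Dspan (mem_powers x (leq0n n)) (oner_neq0 _). Qed.

Lemma mulset_powersD (x : K) m n :
  mulset (Dspan (powers x m)) (Dspan (powers x n)) `<=` Dspan (powers x (m + n)).
Proof.
rewrite mulset_Dspan; apply: Dspan_sub; first exact: Dspan_submodule.
move=> _ /allpairsP[[y z] /= [/mapP[i + ->] /mapP[j + ->] ->]].
rewrite !mem_iota /= !add0n !ltnS -exprD => im jn.
exact/Dspan_mem/mem_powers/leq_add.
Qed.

(** For an overring [T] this is [T[x]], written as an increasing union so that finitely many
    elements share a degree bound [n]. *)
Definition adjoin T (x : K) : set K :=
  [set y | exists n, mulset T (Dspan (powers x n)) y].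

Lemma mulset_powers_mono W (x : K) m n : (m <= n)%N ->
  mulset W (Dspan (powers x m)) `<=` mulset W (Dspan (powers x n)).
Proof. by move=> lemn; apply: mulset_mono => //; exact/Dspan_mono/powers_sub. Qed.

Lemma adjoin_ext T (x : K) : T `<=` adjoin T x.
Proof.
move=> y Ty; exists 0%N; rewrite -[y]mulr1; apply: mulset_mul => //.
exact: Dspan_mem (mem_powers x (leq0n 0)).
Qed.

Lemma adjoin_overring T (x : K) : is_overring T -> is_overring (adjoin T x).
Proof.
move=> ovT; have [T1 TB TM TD] := (overringP T).1 ovT.
have subT := overring_submodule ovT.
apply/overringP; split.
- exact: adjoin_ext.
- move=> y z [m Ty] [n Tz]; exists (maxn m n).
  have [_ + _] := (submoduleP _).1 (mulset_submodule (Dspan (powers x (maxn m n))) subT).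
  apply; first exact: mulset_powers_mono (leq_maxl m n) _ Ty.
  exact: mulset_powers_mono (leq_maxr m n) _ Tz.
- move=> y z [m Ty] [n Tz]; exists (m + n)%N.
  apply: mulset_mono (mulset_mulACA Ty Tz); last exact: mulset_powersD.
  by apply: mulset_sub => //; exact: submodule_add_closed.
- by move=> d; exact: adjoin_ext.
Qed.

Lemma adjoin_mem T (x : K) : is_overring T -> adjoin T x x.
Proof.
move=> /overringP[T1 _ _ _]; exists 1%N; rewrite -[X in mulset _ _ X]mul1r.
by apply: mulset_mul => //; exact: Dspan_mem (mem_powers x (leqnn 1)).
Qed.

(** Products stay inside by [fin_star_mul], since [T T] lies in [T]. *)
Lemma fin_star_overring T : is_overring T -> is_overring (fin_star T).
Proof.
move=> ovT; have [T1 TB TM TD] := (overringP T).1 ovT.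
have [_ FB _] := (submoduleP _).1 (fin_star_submodule T).
apply/overringP; split=> //; first exact: fin_star_ext.
  move=> x y Tx Ty; apply: fin_star_mono (fin_star_mul Tx Ty).
  apply: mulset_sub => //; exact/submodule_add_closed/overring_submodule.
by move=> d; exact: fin_star_ext.
Qed.

Lemma mulset_adjoin E T (x : K) y : mulset E (adjoin T x) y ->
  exists n, mulset (mulset E T) (Dspan (powers x n)) y.
Proof.
pose C : set K := [set y | exists n, mulset (mulset E T) (Dspan (powers x n)) y].
suff : mulset E (adjoin T x) `<=` C by apply.
apply: mulset_sub => [|e a Ee [n Ta]]; last first.
  by exists n; rewrite -mulsetA; exact: mulset_mul.
split=> [|u v [m Cu] [n Cv]]; first by exists 0%N; exact: mulset0.
exists (maxn m n); apply: mulsetD.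
  exact: mulset_powers_mono (leq_maxl m n) _ Cu.
exact: mulset_powers_mono (leq_maxr m n) _ Cv.
Qed.

(** The outer closure absorbs the inner one; the finitely many generators that remain have a common
    degree bound. *)
Lemma fin_star_adjoin E T (x z : K) :
  fin_star (mulset E (fin_star (adjoin T x))) z ->
  exists n, fin_star (mulset (mulset E T) (Dspan (powers x n))) z.
Proof.
move=> /(fin_star_mono (@mulset_fin_star _ _))/fin_star_idem[s sE sz].
have [|m n _ _|y ys|n _ sn] := @common_index _ _ _ (fun=> True)
    (fun n => mulset (mulset E T) (Dspan (powers x n))) id s.
- by exists 0%N.
- exists (maxn m n); split=> //; apply: mulset_powers_mono.
    exact: leq_maxl.
  exact: leq_maxr.
- by have [n ?] := mulset_adjoin (sE _ ys); exists n.
- by exists n, s.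
Qed.

(* With [I = (1, x, ..., x^(m+n))] the two hypotheses give [I z <= (W I)^star_f],
   where [I] can be cancelled. *)
Lemma eab_adjoin W (x z : K) m n : x != 0 ->
  fin_star (mulset W (Dspan (powers x m))) z ->
  fin_star (mulset W (Dspan (powers x^-1 n))) z -> fin_star W z.
Proof.
move=> x0 Wx WxV.
(* Multiplication by [x ^+ i] sends [(1, ..., x^k)] into [(1, ..., x^(k+l))] when [i <= l]. *)
have shift k l i : (i <= l)%N ->
    fin_star (mulset W (Dspan (powers x k))) `<=`
    [set y | fin_star (mulset W (Dspan (powers x (k + l)))) (x ^+ i * y)].
  move=> il y Wy /=; rewrite mulrC.
  have xi : fin_star (Dspan (powers x l)) (x ^+ i).
    exact/fin_star_ext/Dspan_mem/mem_powers.
  apply: fin_star_mono (fin_star_mul Wy xi).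
  by rewrite -mulsetA; apply: mulset_mono => //; exact: mulset_powersD.
(* Multiplication by [x ^+ n] turns [(1, ..., x^-n)] into [(1, ..., x^n)]. *)
have WxVn : fin_star (mulset W (Dspan (powers x n))) (x ^+ n * z).
  have xn : fin_star (Dspan [:: x ^+ n]) (x ^+ n).
    by apply/fin_star_ext/Dspan_mem; rewrite inE.
  apply: fin_star_mono (fin_star_mul xn WxV).
  rewrite mulsetA (mulsetC _ W) -mulsetA mulset_Dspan; apply: mulset_mono => //.
  apply: Dspan_sub; first exact: Dspan_submodule.
  move=> _ /allpairsP[[a b] /= [+ + ->]].
  rewrite inE => /eqP-> /mapP[i + ->]; rewrite mem_iota /= add0n ltnS => lein.
  by rewrite exprVn -expfB_cond ?(negPf x0) //; apply/Dspan_mem/mem_powers/leq_subr.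
apply: (@eab_fin_star W z (powers x (m + n))) => [|_ /mapP[i + ->]].
  exact: powers_nonzero.
rewrite mem_iota /= add0n ltnS => imn.
(* For [i <= n], shift the first hypothesis by [x ^+ i]; otherwise shift [x ^+ n * z] by
   [x ^+ (i - n)], where [i - n <= m]. *)
have [lein|ltni] := leqP i n; first exact: shift.
rewrite -(subnK (ltnW ltni)) exprD -mulrA (addnC m); apply: shift => //.
by rewrite leq_subLR addnC.
Qed.

(** * Valuation overrings from Zorn's lemma *)

Lemma exists_valuation_overring E z : is_submodule E -> ~ fin_star E z -> exists T,
  [/\ is_valuation_overring T, fin_star T `<=` T & ~ mulset E T z].
Proof.
move=> subE nEz.
pose good T := is_overring T /\ ~ fin_star (mulset E T) z.
have goodD : good (range (fun a : D => a%:F : K)).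
  split.
    apply/overringP; split.
    - by exists 1 => //; exact: rmorph1.
    - by move=> _ _ [a _ <-] [b _ <-]; exists (a - b) => //; exact: rmorphB.
    - by move=> _ _ [a _ <-] [b _ <-]; exists (a * b) => //; exact: rmorphM.
    - by move=> d; exists d.
  apply: contra_not nEz; apply: fin_star_mono.
  apply: mulset_sub; first exact: submodule_add_closed.
  by move=> x _ Ex [a _ <-]; rewrite mulrC; have [_ _] := (submoduleP E).1 subE; apply.
(* The guard [T !=set0] admits the empty set, which is the union of the empty chain. *)
have [|T [+ maxT]] := @Zorn_bigcup K [set T | T !=set0 -> good T].
  move=> F Fgood totF [t [T0 FT0 T0n0]].
  have dirF S S' : F S -> F S' -> exists2 S'', F S'' & S `<=` S'' /\ S' `<=` S''.
    move=> FS FS'; have [sub|sub] := totF _ _ FS FS'.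
      by exists S' => //; split.
    by exists S => //; split.
  have goodF S x : F S -> S x -> good S by move=> /Fgood + Sx; apply; exists x.
  have [ov0 nz0] := goodF _ _ FT0 T0n0.
  have [one0 _ _ D0] := (overringP T0).1 ov0.
  split.
    apply/overringP; split.
    - by exists T0.
    - move=> x y [S FS Sx] [S' FS' Sy]; have [S'' FS'' [sub sub']] := dirF _ _ FS FS'.
      exists S'' => //; have [ov _] := goodF _ _ FS'' (sub _ Sx).
      by have [_ + _ _] := (overringP _).1 ov; apply; [exact: sub | exact: sub'].
    - move=> x y [S FS Sx] [S' FS' Sy]; have [S'' FS'' [sub sub']] := dirF _ _ FS FS'.
      exists S'' => //; have [ov _] := goodF _ _ FS'' (sub _ Sx).
      by have [_ _ + _] := (overringP _).1 ov; apply; [exact: sub | exact: sub'].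
    - by move=> d; exists T0.
  (* Containing [1] discards a possible empty member of the chain. *)
  pose Q S := F S /\ S 1.
  have dirQ S S' : Q S -> Q S' ->
      exists S'', [/\ Q S'', mulset E S `<=` mulset E S''
                   & mulset E S' `<=` mulset E S''].
    move=> [FS S1] [FS' _]; have [S'' FS'' [sub sub']] := dirF _ _ FS FS'.
    exists S''; split; try exact: mulset_mono.
    by split=> //; exact: sub.
  move=> [s sE sz].
  (* A finite sum of products uses finitely many elements of the union, hence a single ring of the
     chain. *)
  have sub : mulset E (\bigcup_(S in F) S) `<=` [set y | exists2 S, Q S & mulset E S y].
    apply: mulset_sub => [|e a Ee [S FS Sa]].
      split; first by exists T0 => //; exact: mulset0.
      move=> u v [S QS Su] [S' QS' Sv]; have [S'' [QS'' sub sub']] := dirQ _ _ QS QS'.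
      by exists S'' => //; apply: mulsetD; [exact: sub | exact: sub'].
    exists S; last exact: mulset_mul.
    by split=> //; have [ov _] := goodF _ _ FS Sa; have [] := (overringP _).1 ov.
  have QT0 : exists S, Q S by exists T0.
  have [S [FS S1] sS] := common_index (f := id) QT0 dirQ (fun x xs => sub x (sE x xs)).
  by have [_] := goodF _ _ FS S1; apply; exists s.
case: (pselect (T !=set0)) => [T0 /(_ T0) [ovT nzT]|T0 _]; last first.
  (* The empty set is not maximal: the image of [D] is larger and good. *)
  exfalso; apply: (maxT (range (fun a : D => a%:F : K))) => //.
  split=> [x Tx|sub]; first by exfalso; apply: T0; exists x.
  by apply: T0; exists 0; apply: sub; exists 0; rewrite ?rmorph0.
have [T1 TB TM TD] := (overringP T).1 ovT.
(* Comparing [T] with the closure of [T[x]] rather than [T[x]] itself also gives closedness of [T],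
   by taking [x = 1]. *)
pose cl x := fin_star (adjoin T x).
have T_cl x : T `<=` cl x.
  by move=> y Ty; exact/fin_star_ext/adjoin_ext.
have maxcl x : ~ fin_star (mulset E (cl x)) z -> cl x `<=` T.
  move=> nz; apply: contrapT => ncl; apply: (maxT (cl x)); first by split.
  by move=> _; split=> //; exact/fin_star_overring/adjoin_overring.
have dicho x : x != 0 -> cl x `<=` T \/ cl x^-1 `<=` T.
  move=> x0; have [clx|/maxcl] := pselect (fin_star (mulset E (cl x)) z); last by left.
  right; apply: maxcl => clxV; apply: nzT.
  have [m zm] := fin_star_adjoin clx; have [n zn] := fin_star_adjoin clxV.
  exact: eab_adjoin x0 zm zn.
exists T; split.
- have [subT DT] := ovT; split=> // x x0; have [clT|clT] := dicho _ x0; [left|right].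
    exact/clT/fin_star_ext/adjoin_mem.
  exact/clT/fin_star_ext/adjoin_mem.
(* For [x = 1] both alternatives of [dicho] are the same inclusion. *)
- have cl1 : cl 1 `<=` T by have := dicho _ (oner_neq0 _); rewrite invr1 => -[].
  by move=> y Ty; apply: cl1; apply: fin_star_mono Ty; exact: adjoin_ext.
- by move=> Tz; apply: nzT; exact: fin_star_ext.
Qed.

(** * Comparison of [star_f] with [star_a] *)

Lemma star_f_star_a E : Fbar E -> star_f star E = star_a star E.
Proof.
move=> FE; apply/seteqP; split=> z.
  (* The witness is [H = F], as [star F] times [star F] lies in [star (mulset F F)]. *)
  move=> [F [fgF FE'] Fz]; exists F => //; exists F => // _ [x Fx <-].
  by have [[subF _] _ _] := fgF; exact: star_mul.
move=> [F [[_ _ [s ->]] sE] [H [_ Hn0 [l Hl]] colz]]; rewrite {}Hl in Hn0 colz.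
rewrite star_fE //; apply: (fin_star_mono sE).
(* Cancel [H], whose generators are [l]. *)
apply: (eab_fin_star Hn0) => x xl.
exists [seq a * b | a <- s, b <- l] => [_ /allpairsP[[a b] [sa lb ->]]|].
  by apply: mulset_mul; exact: Dspan_mem.
rewrite -mulset_Dspan mulrC; apply: colz; exists x => //.
by apply: star_ext; [exact: Dspan_submodule | exact: Dspan_mem].
Qed.

(** * Valuation overrings and Gauss' lemma *)

Section Valuation.
Variable V : set K.
Hypothesis valV : is_valuation_overring V.

Lemma valuation_closed :
  [/\ V 1, forall x y, V x -> V y -> V (x - y), forall x y, V x -> V y -> V (x * y)
    & forall d : D, V d%:F].
Proof. by apply/overringP; case: valV. Qed.

Lemma valuation_add_closed : add_closed V.
Proof.
by apply/submodule_add_closed/overring_submodule; case: valV.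
Qed.

(** Divisibility in [V] is total, so some generator [a] has least value, and [Dspan s] generates
    [a V] over [V]. *)
Lemma valuation_min s : Dspan s <> [set 0] ->
  exists a, [/\ a \in s, a != 0 & forall x, x \in s -> V (x / a)].
Proof.
have [V1 _ VM _] := valuation_closed; have [V0 _] := valuation_add_closed.
have [_ _ Vdicho] := valV.
(* Allowing an all-zero list makes the claim inductive. *)
suff : (forall x, x \in s -> x = 0) \/
    exists a, [/\ a \in s, a != 0 & forall x, x \in s -> V (x / a)].
  move=> [s0 []|//]; apply/seteqP; split=> [x|_ ->].
    by apply: Dspan_sub => //; exact: submodule_zero.
  by have [] := (submoduleP _).1 (Dspan_submodule s).
elim: s => [|b s [s0|[a [sa a0 Va]]]]; first by left.
  have [->|b0] := eqVneq b 0.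
    by left=> x; rewrite inE => /orP[/eqP|/s0].
  right; exists b; split; rewrite ?mem_head // => x.
  by rewrite inE => /orP[/eqP->|/s0 ->]; rewrite ?divff ?mul0r.
right; have [->|b0] := eqVneq b 0.
  exists a; split; rewrite ?inE ?sa ?orbT // => x.
  by rewrite inE => /orP[/eqP->|/Va]; rewrite ?mul0r.
have [Vba|] := Vdicho (b / a) (mulf_neq0 b0 (invr_neq0 a0)).
  exists a; split; rewrite ?inE ?sa ?orbT // => x.
  by rewrite inE => /orP[/eqP->|/Va].
rewrite invf_div => Vab; exists b; split; rewrite ?mem_head // => x.
rewrite inE => /orP[/eqP->|/Va Vx]; first by rewrite divff.
by rewrite -[x](divfK a0) -(mulrA _ a); exact: VM.
Qed.

(** Divide [F] by a generator [a] of least value: [F / a] lies in [V], hence so does its star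
    closure, and [star F] lies in [a V]. *)
Lemma fin_star_closed_valuation : fin_star V `<=` V ->
  is_star_valuation_overring star V.
Proof.
move=> starV; split=> // F [_ Fn0 [s Fs]] z; rewrite Fs in Fn0 * => sz.
have [a [sa a0 Va]] := valuation_min Fn0.
rewrite -[z](mulVKf a0); apply: mulset_mul; first exact: Dspan_mem.
apply: starV; exists [seq a^-1 * x | x <- s] => [_ /mapP[x xs ->]|].
  by rewrite mulrC; exact: Va.
apply: star_mono (star_scale a^-1 (Dspan_submodule s) sz).
- exact/scaleset_submodule/Dspan_submodule.
- exact: Dspan_submodule.
move=> _ [_ [c ->] <-]; rewrite mulr_sumr.
apply: add_closed_sum => [|i]; first exact/submodule_add_closed/Dspan_submodule.
have [_ _ DZ] := (submoduleP _).1 (Dspan_submodule [seq a^-1 * x | x <- s]).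
rewrite mulrCA.
by apply/DZ/Dspan_mem/map_f/mem_nth.
Qed.

(** For [x] in [V]: a unit of [V]. The inequality matters, since [0^-1 = 0] lies in [V]. *)
Definition val_unit (x : K) := x != 0 /\ V x^-1.

(** The maximal ideal of [V]. *)
Definition val_ideal : set K := [set x | V x /\ ~ val_unit x].

Lemma val_ideal_mul x y : val_ideal x -> V y -> val_ideal (x * y).
Proof.
have [_ _ VM _] := valuation_closed.
move=> [Vx nx] Vy; split; first exact: VM.
move=> [xy0 Vxy]; apply: nx; move: (xy0); rewrite mulf_eq0 negb_or => /andP[x0 y0].
split=> //; have -> : x^-1 = y * (x * y)^-1 by rewrite invfM mulrCA divff ?mulr1.
exact: VM.
Qed.

Lemma val_ideal_add_closed : add_closed val_ideal.
Proof.
have [V1 _ VM _] := valuation_closed; have [V0 VD] := valuation_add_closed.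
have [_ _ Vdicho] := valV.
split; first by split=> // -[]; rewrite eqxx.
(* If [x] divides [y], it divides [x + y], so it is a unit as soon as [x + y] is. *)
have half x y : x != 0 -> V (y / x) -> val_unit (x + y) -> val_unit x.
  move=> x0 Vyx [xy0 Vxy]; split=> //.
  have -> : x^-1 = (1 + y / x) * (x + y)^-1.
    by rewrite -[1](divff x0) -mulrDl mulrAC divff ?mul1r.
  by apply: VM => //; exact: VD.
move=> x y [Vx nx] [Vy ny]; split; first exact: VD.
have [->|x0] := eqVneq x 0; first by rewrite add0r.
have [->|y0] := eqVneq y 0; first by rewrite addr0.
have [Vxy|] := Vdicho (x / y) (mulf_neq0 x0 (invr_neq0 y0)).
  by rewrite addrC; apply: contra_not ny; exact: half.
by rewrite invf_div => Vyx; apply: contra_not nx; exact: half.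
Qed.

(** The polynomials of Gauss value zero. *)
Definition primitive (p : {poly K}) :=
  (forall i, V p`_i) /\ exists k, val_unit p`_k.

Lemma primitive_min p : primitive p ->
  exists2 k, val_unit p`_k & forall i, (i < k)%N -> val_ideal p`_i.
Proof.
move=> [Vp [k0 pk0]].
have ex : exists k, `[< val_unit p`_k >] by exists k0; exact/asboolP.
case: (ex_minnP ex) => k /asboolP pk kmin; exists k => // i ik; split=> //.
by move=> /asboolP /kmin; rewrite leqNgt ik.
Qed.

(* Gauss' lemma: modulo the maximal ideal, the product of the two lowest unit
   coefficients survives. *)
Lemma primitive_mul p q : primitive p -> primitive q -> primitive (p * q).
Proof.
have [_ _ VM _] := valuation_closed; have [VI0 VID] := val_ideal_add_closed.
move=> prp prq; have [[Vp _] [Vq _]] := (prp, prq).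
have Vpq i : V (p * q)`_i.
  rewrite coefM; apply: add_closed_sum; first exact: valuation_add_closed.
  by move=> j; exact: VM.
split=> //; have [k [pk0 Vpk] pmin] := primitive_min prp.
have [l [ql0 Vql] qmin] := primitive_min prq.
exists (k + l)%N; apply: contrapT => nunit.
have : val_ideal (p`_k * q`_l); last first.
  by case=> _; apply; split; rewrite ?mulf_neq0 // invfM; exact: VM.
have ltk : (k < (k + l).+1)%N by rewrite ltnS leq_addr.
(* If the coefficient of degree [k + l] were a nonunit, the unit [p_k q_l] would be a sum of
   elements of the maximal ideal. *)
have -> : p`_k * q`_l = (p * q)`_(k + l) +
    \sum_(i < (k + l).+1 | i != Ordinal ltk) - (p`_i * q`_(k + l - i)).
  rewrite coefM (bigD1 (Ordinal ltk)) //= addKn sumrN.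
  by rewrite -addrA subrr addr0.
apply: (VID); first by split.
apply: (big_ind val_ideal) => [//|x y|i ik]; first exact: VID.
have VN x : val_ideal x -> val_ideal (- x).
  have [V1 VB _ _] := valuation_closed; have [V0 _] := valuation_add_closed.
  by rewrite -mulrN1 => /val_ideal_mul; apply; rewrite -[- 1]add0r; exact: VB.
(* Either [i < k], or [i > k] and then [k + l - i < l]: one factor has index below the first
   unit. *)
apply: VN; have [ltik|leki] := ltnP i k.
  by apply: val_ideal_mul => //; exact: pmin.
rewrite mulrC; apply: val_ideal_mul => //; apply: qmin.
have ltki : (k < i)%N.
  by rewrite ltn_neqAle leki andbT; apply: contraNneq ik => ki; apply/eqP/val_inj.
by rewrite ltn_subLR ?ltn_add2r // -ltnS.
Qed.

End Valuation.

(** * Contents, and the inclusion of [star_f] in the Kronecker closure *)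

Lemma content_submodule (h : {poly D}) : is_submodule (content h).
Proof. exact: Dspan_submodule. Qed.

Lemma content_coef (h : {poly D}) i : content h (h`_i)%:F.
Proof.
have [lti|lei] := ltnP i (size h).
  exact/Dspan_mem/map_f/mem_nth.
rewrite nth_default // tofrac0.
by have [] := (submoduleP _).1 (content_submodule h).
Qed.

Lemma content_sub (h : {poly D}) E : is_submodule E ->
  (forall i, E (h`_i)%:F) -> content h `<=` E.
Proof.
move=> subE hE; apply: Dspan_sub => // _ /mapP[c /(nthP 0)[i _ <-] ->].
exact: hE.
Qed.

Lemma content_nonzero (h : {poly D}) : h != 0 -> content h <> [set 0].
Proof.
rewrite -lead_coef_eq0 -tofrac_eq0 => h0 c0.
by move: (content_coef h (size h).-1) h0; rewrite c0 /= lead_coefE => ->; rewrite eqxx.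
Qed.

(** The content of [1] is [D], which permits [h = 1] in the definition of [Kr]. *)
Lemma content_mul1 E : is_submodule E -> mulset E (content (1 : {poly D})) = E.
Proof.
move=> subE; have [_ _ EZ] := (submoduleP _).1 subE; apply/seteqP; split.
  apply: mulset_sub; first exact: submodule_add_closed.
  move=> x y Ex; rewrite /content polyseq1 /= => -[c ->].
  by rewrite big_ord1 /= tofrac1 mulr1 mulrC; exact: EZ.
move=> x Ex; rewrite -[x]mulr1; apply: mulset_mul => //.
by have := content_coef 1 0; rewrite coef1 tofrac1.
Qed.

Local Notation KX := {fraction {poly {fraction D}}}.
Local Notation lift := (map_poly (fun a : D => a%:F : K)).

Lemma coef_lift (f : {poly D}) i : (lift f)`_i = (f`_i)%:F.
Proof. by rewrite coef_map_id0 // tofrac0. Qed.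

Lemma lift_eq0 (f : {poly D}) : (lift f == 0) = (f == 0).
Proof.
apply/eqP/eqP=> [/polyP f0|->]; apply/polyP=> i.
  by apply/eqP; rewrite coef0 -tofrac_eq0 -coef_lift f0 coef0.
by rewrite coef_lift !coef0 tofrac0.
Qed.

(* If [z] lies in [star (Dspan s)], then [z = \sum_i s_i (X^i z / g)] where
   [g = \sum_i s_i X^i], and each [X^i z / g] is in the Kronecker ring. *)
Lemma fin_star_Kr_star E : Fbar E -> fin_star E `<=` Kr_star star E.
Proof.
move=> FE z [s sE sz]; rewrite /Kr_star /=.
have [->|z0] := eqVneq z 0; first by rewrite /K_to_KX polyC0 tofrac0; exact: mulset0.
(* [Kr] uses polynomials over [D], so numerator and denominator are both scaled by [d]: [c = d z],
   and [g] has coefficients [d s_i]. *)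
have [d d0 dP] := common_denominator (z :: s).
have dF0 : d%:F != 0 :> K by rewrite tofrac_eq0.
have [c cz] := dP _ (mem_head _ _).
have /choice[a aP] i : exists a : D, d%:F * s`_i = a%:F.
  have [lti|lei] := ltnP i (size s); first by apply: dP; rewrite inE mem_nth ?orbT.
  by exists 0; rewrite nth_default // mulr0 tofrac0.
pose g : {poly D} := \poly_(i < size s) a i.
have ga i : (g`_i)%:F = d%:F * s`_i.
  rewrite coef_poly aP; case: ltnP => // lei.
  by rewrite -aP nth_default // mulr0 tofrac0.
have sg : Dspan s `<=` scaleset d%:F^-1 (content g).
  apply: Dspan_sub; first exact/scaleset_submodule/content_submodule.
  move=> x /(nthP 0)[i _ <-]; exists (g`_i)%:F; first exact: content_coef.
  by rewrite ga mulKf.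
have gz : star (content g) c%:F.
  rewrite -cz -(star_idem (content_submodule g)).
  apply: star_mono (star_scale d%:F (Dspan_submodule s) sz).
  - exact/scaleset_submodule/Dspan_submodule.
  - exact/star_submodule/content_submodule.
  move=> _ [x /sg[y gy <-] <-]; rewrite mulVKf //.
  exact: star_ext (content_submodule g) _ gy.
have g0 : g != 0.
  apply: contraNneq z0 => g0; move: gz; rewrite -cz g0.
  have -> : content (0 : {poly D}) = [set 0].
    apply/seteqP; split=> [|_ ->]; last first.
      by have [] := (submoduleP _).1 (content_submodule (0 : {poly D})).
    by apply: content_sub => [|i]; [exact: submodule_zero | rewrite coef0 tofrac0].
  by rewrite semistar_zero //= => /eqP; rewrite mulf_eq0 (negPf dF0).
have lg0 : (lift g)%:F != 0 :> KX by rewrite tofrac_eq0 lift_eq0.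
exists (size s), (fun i => K_to_KX s`_i), (fun i => DX_to_KX (c%:P * 'X^i) / DX_to_KX g).
split=> [i|].
  split; first by exists s`_i => //; exact/sE/mem_nth.
  (* The content of [c X^i] is generated by [c], which lies in [star (content g)]. *)
  exists (c%:P * 'X^i), g; split=> //; exists 1; first exact: oner_neq0.
  rewrite !content_mul1; try exact: content_submodule.
  rewrite -(star_idem (content_submodule g)); apply: star_mono.
  - exact: content_submodule.
  - exact/star_submodule/content_submodule.
  apply: content_sub => [|j]; first exact/star_submodule/content_submodule.
  rewrite coefCM coefXn; case: eqP => _; first by rewrite mulr1.
  rewrite mulr0 tofrac0.
  by have [] := (submoduleP _).1 (star_submodule (content_submodule g)).
(* After multiplication by [g], both coefficients of [X^k] equal [d z s_k], with default [s_k = 0]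
   past the end of [s]. *)
apply: (mulIf lg0); rewrite mulr_suml.
under eq_bigr => i _ do rewrite mulrA divfK // -tofracM.
rewrite -rmorph_sum /= -tofracM; congr (_%:F); apply/polyP=> k.
rewrite coefCM coef_lift ga coef_sum.
under eq_bigr => i _ do rewrite coefCM coef_lift coefCM coefXn.
have [ltk|lek] := ltnP k (size s).
  rewrite (bigD1 (Ordinal ltk)) //= eqxx mulr1 big1 ?addr0 => [|i].
    by rewrite -cz mulrC -mulrA mulrCA.
  rewrite -val_eqE eq_sym /= => /negPf ->.
  by rewrite mulr0 tofrac0 mulr0.
rewrite nth_default // !mulr0 big1 // => i _.
by rewrite gtn_eqF ?mulr0 ?tofrac0 ?mulr0 // (leq_trans (ltn_ord i)).
Qed.

(** * The Kronecker ring inside Gauss extensions *)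

Section GaussExtension.
Variable V : set K.
Hypothesis starV : is_star_valuation_overring star V.
Let valV : is_valuation_overring V := starV.1.

(* The [E]-multiples of the Gauss extension of [V] to [K(X)]. *)
Definition gauss E : set KX :=
  [set phi | exists p q : {poly K},
    [/\ primitive V p, forall i, mulset E V q`_i & phi * p%:F = q%:F]].

Lemma mulset_valuation E x v : mulset E V x -> V v -> mulset E V (x * v).
Proof.
have [_ _ VM _] := valuation_closed valV.
move=> Ex Vv; rewrite mulrC mulsetC; rewrite mulsetC in Ex.
by apply: mulset_mull Ex => w; exact: VM.
Qed.

(** The common denominator [p * p'] is primitive by Gauss' lemma. *)
Lemma gauss_add_closed E : add_closed (gauss E).
Proof.
have [V1 _ VM _] := valuation_closed valV; have [V0 _] := valuation_add_closed valV.
have coefV (q p : {poly K}) : (forall i, mulset E V q`_i) -> primitive V p ->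
    forall i, mulset E V (q * p)`_i.
  move=> Eq [Vp _] i; rewrite coefM; apply: add_closed_sum => [|j].
    exact: mulset_add_closed.
  exact: mulset_valuation.
split=> [|phi psi [p [q [prp Eq phiE]]] [p' [q' [prp' Eq' psiE]]]].
  exists 1, 0; split=> [|i|]; last by rewrite mul0r tofrac0.
    2: by rewrite coef0; exact: mulset0.
  split=> [i|]; first by rewrite coef1; case: (i == 0).
  by exists 0%N; rewrite coef1; split; rewrite ?invr1 ?oner_neq0.
exists (p * p'), (q * p' + q' * p); split; first exact: primitive_mul.
  by move=> i; rewrite coefD; apply: mulsetD; exact: coefV.
by rewrite tofracD !tofracM mulrDl mulrA phiE (mulrC p%:F) mulrA psiE.
Qed.

(** Take coefficients [b] of [g] and [a] of [h] of least value. Since [V] is a star-valuation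
    overring, [f_i a] lies in [content g] times [content h] times [V], hence in [b a V]; then cancel
    [a]. *)
Lemma Kr_coef (f g h : {poly D}) : g != 0 -> h != 0 ->
  star (mulset (content f) (content h)) `<=` star (mulset (content g) (content h)) ->
  exists b, [/\ b != 0, exists k, (g`_k)%:F = b, forall i, V ((g`_i)%:F / b)
    & forall i, V ((f`_i)%:F / b)].
Proof.
move=> g0 h0 fgh; have [_ _ VM _] := valuation_closed valV; have [subringV DV _] := valV.
have [a [ha a0 Va]] := valuation_min valV (content_nonzero h0).
have [b [gb b0 Vb]] := valuation_min valV (content_nonzero g0).
have subV x : is_submodule [set y | V (y / x)].
  have [V0 VB VZ] := (submoduleP V).1 (overring_submodule (conj subringV DV)).
  apply/submoduleP; split=> /= [|u v Vu Vv|c u Vu]; first by rewrite mul0r.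
    by rewrite mulrBl; exact: VB.
  by rewrite -mulrA; exact: VZ.
have gV : content g `<=` [set y | V (y / b)] by exact: Dspan_sub.
have hV : content h `<=` [set y | V (y / a)] by exact: Dspan_sub.
exists b; split=> //.
- move: gb => /mapP[c /(nthP 0)[k _ <-] ->]; by exists k.
- by move=> i; apply/gV/content_coef.
move=> i; have fiha : mulset (content f) (content h) ((f`_i)%:F * a).
  by apply: mulset_mul; [exact: content_coef | exact: Dspan_mem].
have subch (k : {poly D}) : is_submodule (mulset (content k) (content h)).
  exact/mulset_submodule/content_submodule.
have fgch : fgideals (mulset (content g) (content h)).
  rewrite /content mulset_Dspan; apply: fgideals_Dspan.
  by apply: (nonzero_Dspan _ (mulf_neq0 b0 a0)); exact: allpairs_f.
have := starV.2 _ fgch _ (fgh _ (star_ext (subch f) fiha)).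
suff sub : mulset (mulset (content g) (content h)) V `<=` [set y | V (y / (b * a))].
  by move=> /sub /=; rewrite invfM mulrACA divff // mulr1.
apply: mulset_sub => [|y v ghy Vv /=]; first exact/submodule_add_closed/subV.
rewrite mulrAC; apply: (VM) => //; move: y ghy.
apply: (mulset_sub (submodule_add_closed (subV (b * a)))) => u w /gV Vu /hV Vw /=.
by rewrite invfM mulrACA; exact: VM.
Qed.

Lemma Kr_gauss E e phi : E e -> Kr star phi -> gauss E (K_to_KX e * phi).
Proof.
move=> Ee [f [g [g0 [h h0 fgh] ->]]].
have [b [b0 [k gk] Vg Vf]] := Kr_coef g0 h0 fgh.
have [V1 _ _ _] := valuation_closed valV.
(* Division by [b] makes [g] primitive and puts the coefficients of [f] in [V]. *)
exists (b^-1 *: lift g), ((e / b) *: lift f); split.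
- split=> [i|]; first by rewrite coefZ coef_lift mulrC.
  by exists k; rewrite coefZ coef_lift gk mulVf //; split; rewrite ?oner_neq0 ?invr1.
- by move=> i; rewrite coefZ coef_lift -mulrA (mulrC b^-1); exact: mulset_mul.
rewrite -!mul_polyC !tofracM -mulrA (mulrCA (_ / _)) divfK; last first.
  by rewrite tofrac_eq0 lift_eq0.
by rewrite polyCM tofracM mulrA.
Qed.

(** Compare coefficients at an index [k] where [p_k] is a unit: [z p_k = q_k]. *)
Lemma gauss_polyC E z : gauss E (K_to_KX z) -> mulset E V z.
Proof.
move=> [p [q [[_ [k [pk0 Vpk]]] Eq]]]; rewrite -tofracM => /eqP.
rewrite tofrac_eq => /eqP/polyP/(_ k); rewrite coefCM => zpk.
by rewrite -[z](mulfK pk0) zpk; exact: mulset_valuation.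
Qed.

End GaussExtension.

(** * Closing the cycle of inclusions *)

Lemma Kr_star_bstar E : Kr_star star E `<=` bstar star E.
Proof.
move=> z Kz V starV; apply: (gauss_polyC starV); move: Kz.
apply: mulset_sub; first exact: gauss_add_closed.
by move=> _ phi [e Ee <-] Kphi; exact: Kr_gauss.
Qed.

Lemma bstar_fin_star E : Fbar E -> bstar star E `<=` fin_star E.
Proof.
move=> [subE _] z bz; apply: contrapT => nz.
have [V [valV starV nEV]] := exists_valuation_overring subE nz.
by apply/nEV/bz; exact: fin_star_closed_valuation.
Qed.

End Semistar.

Theorem proposition9 (D : idomainType)
    (star : set {fraction D} -> set {fraction D})
    (star_semistar : is_semistar star) (star_eab : eab star) :
  [/\ {in @Fbar D, star_f star =1 Kr_star star},
      {in @Fbar D, Kr_star star =1 bstar star}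
    & {in @Fbar D, bstar star =1 star_a star}].
Proof.
(* The cycle [star_f], [Kr_star], [bstar], [star_f] of inclusions gives the first equalities;
   [star_a] joins through [star_f]. *)
have fKr E : Fbar E -> star_f star E = Kr_star star E.
  move=> FE; apply/seteqP; split; rewrite star_fE //; first exact: fin_star_Kr_star.
  move=> z /(Kr_star_bstar star_semistar); exact: bstar_fin_star.
have Krb E : Fbar E -> Kr_star star E = bstar star E.
  move=> FE; apply/seteqP; split; first exact: Kr_star_bstar.
  move=> z /(bstar_fin_star star_semistar star_eab FE).
  exact: fin_star_Kr_star.
split=> E; rewrite in_setE => FE; [exact: fKr | exact: Krb |].
by rewrite -Krb // -fKr // star_f_star_a.
Qed.
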